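(* Let $\mu$ be a positive Radon measure on $\mathbb{R}_+=[0,\infty)$ having finite moments of all orders (i.e. $\int_{\mathbb{R}_+} t^n\,d\mu(t)<\infty$ for all $n\in\mathbb{N}$) and satisfying $\mu\big(\mathbb{R}_+\setminus[0,s_\mu)\big)=0$, where $s_\mu:=\sup\{x: x\in\mathrm{supp}(\mu)\}\in[0,\infty]$. Let $\mathcal{W}=\{w_n\}_{n=0}^\infty$ be a sequence in a real Hilbert space $\mathscr{K}$ and assume there is a constant $C>0$ such that \[ \Big\|\sum_{n=0}^\infty a_n w_n\Big\|_{\mathscr{K}}\le C\Big\|\sum_{n=0}^\infty a_n t^n\Big\|_{L^2(\mu)} \] for all finitely supported sequences $\{a_n\}_{n=0}^\infty$ of non-negative real numbers. Let $\mathscr{H}$ be a real Hilbert space, $\{\lambda_n\}_{n=0}^\infty$ a sequence of positive numbers, and $\mathcal{V}=\{v_n\}_{n=0}^\infty\subset\mathscr{H}$ a sequence satisfying \[ \langle \lambda_n v_n,\lambda_m v_m\rangle_{\mathscr{H}}=\int_{\mathbb{R}_+} t^{m+n}\,d\mu(t)+\langle w_n,w_m\rangle_{\mathscr{K}}\quad\text{for all } n,m\in\mathbb{N}. \] Then $\overline{\mathcal{C}}[\mathcal{V}]=\mathcal{C}[[\mathcal{V}]]$; in particular $\mathcal{C}[[\mathcal{V}]]$ is a closed convex cone in $\mathscr{H}$.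
   Context: $\mathbb{N}=\{0,1,2,\dots\}$. For a sequence $\mathcal{V}=\{v_n\}_{n=0}^\infty$ in a real Hilbert space $\mathscr{H}$: $\mathcal{C}[\mathcal{V}]=\{\sum_{n=0}^N a_n v_n : N\in\mathbb{N},\ a_n\ge 0\}$ is the convex cone generated by $\mathcal{V}$, $\overline{\mathcal{C}}[\mathcal{V}]$ is its norm closure in $\mathscr{H}$, and $\mathcal{C}[[\mathcal{V}]]=\{\sum_{n=0}^\infty a_n v_n : a_n\ge 0,\ \text{the series converges in }\mathscr{H}\}$, where convergence means convergence of the partial sums $\sum_{n=0}^N a_nv_n$ as $N\to\infty$. *)

(* Defs.v *)
From HB Require Import structures.
From mathcomp Require Import all_boot all_order all_algebra.
From mathcomp Require Import all_classical all_reals all_analysis.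
Set Implicit Arguments. Unset Strict Implicit. Unset Printing Implicit Defensive.
Import Order.TTheory GRing.Theory Num.Theory.
Import numFieldNormedType.Exports.
Local Open Scope classical_set_scope.
Local Open Scope ring_scope.

(* A real inner product compatible with the norm of V.  Together with
   completeness of V (V : completeNormedModType R) this makes V a real
   Hilbert space with inner product ip. *)
Definition is_inner_product {R : realType} (V : normedModType R)
    (ip : V -> V -> R) : Prop :=
  [/\ (forall x y, ip x y = ip y x),
      (forall (a : R) (x y z : V), ip (a *: x + y) z = a * ip x z + ip y z)
    & (forall x, `|x| ^+ 2 = ip x x)].

Definition msupport {R : realType}
    (mu : {measure set (measurableTypeR R) -> \bar R}) : set R :=
  [set x : R | forall U : set R, open U -> U x -> (0 < mu U)%E].

Definition msup_support {R : realType}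
    (mu : {measure set (measurableTypeR R) -> \bar R}) : \bar R :=
  ereal_sup ((fun x : R => x%:E) @` msupport mu).

Definition cone {R : realType} (V : normedModType R) (v : nat -> V) : set V :=
  [set x | exists (N : nat) (a : nat -> R),
     (forall n, 0 <= a n) /\ x = \sum_(0 <= n < N) a n *: v n].

Definition series_cone {R : realType} (V : normedModType R) (v : nat -> V) : set V :=
  [set x | exists a : nat -> R,
     (forall n, 0 <= a n) /\ series (fun n => a n *: v n) @ \oo --> x].

(* Main.v *)
(* Let v'_n = lambda_n v_n.  For non-negative coefficients |sum a_n v'_n| is
   comparable to the L2(mu)-norm of the polynomial sum a_n t^n, and for arbitrary
   real coefficients it dominates that norm.  If x_k = sum_n a^k_n v'_n converges
   to x, the polynomials p_k are thus Cauchy in L2(mu).  Being non-decreasing on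
   the half-line, they are bounded at every point below sup supp mu, hence so are
   their coefficients; along a subsequence the coefficients converge to some l_n
   and p_k tends pointwise on [0, s_mu) to p = sum_n l_n t^n.  Fatou's lemma gives
   p_k --> p in L2(mu), and dominated convergence shows that the partial sums of p
   converge to p in L2(mu).  The tail of x_k beyond degree N has non-negative
   coefficients, so its norm is controlled by the L2(mu)-norm of the tail of p_k,
   which is asymptotically that of p - S_N p.  Hence |x - sum_(n < N) l_n v'_n|
   tends to 0. *)
Require Import Defs.
From HB Require Import structures.
From mathcomp Require Import all_boot all_order all_algebra.
From mathcomp Require Import all_classical all_reals all_analysis.
From mathcomp Require Import measurable_realfun ring lra.
Import Order.TTheory GRing.Theory Num.Theory.
Import numFieldNormedType.Exports.
Local Open Scope classical_set_scope.
Local Open Scope ring_scope.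

(** * Extraction of coefficientwise convergent subsequences *)

Lemma nbhs_coordinate_ball (R : realType) (l : nat -> R) (e : R) (n : nat) : 0 < e ->
  nbhs (l : {ptws nat -> R}) [set f : {ptws nat -> R} | `|l n - f n| < e].
Proof.
move=> e0; pose pn : {ptws nat -> R} -> R^o := fun f => f n.
have cn : {for (l : {ptws nat -> R}), continuous pn}.
  exact: (@proj_continuous nat (fun=> R^o) n).
exact: cn _ (nbhsx_ballx (l n : R^o) e e0).
Qed.

(* [s] need not be increasing: a cluster point in the compact product (Tychonoff)
   replaces the diagonal argument, and [j <= s j] suffices for limits along [s]. *)
Lemma bounded_diagonal_extraction (R : realType) (a : nat -> nat -> R) (B : nat -> R) :
  (forall k n, 0 <= a k n <= B n) ->
  exists (s : nat -> nat) (l : nat -> R),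
    (forall j, (j <= s j)%N) /\ forall n, a (s j) n @[j --> \oo] --> l n.
Proof.
move=> aB.
pose F : set_system {ptws nat -> R} := (fun k => a k : {ptws nat -> R}) @ \oo.
have FF : ProperFilter F by exact: fmap_proper_filter.
have cpt n : compact (`[0, B n]%classic : set R) by exact: segment_compact.
have [|l [_ Fl]] := @tychonoff _ _ _ cpt F FF.
  by exists 0%N => // k _ n /=; rewrite in_itv /= aB.
(* Being a cluster point, [l] has each of its neighbourhoods met by the sequence at arbitrarily late
   indices. The neighbourhood used here constrains only the first [j] coordinates, hence is open in
   the product topology. *)
have near_l j : exists k, (j <= k)%N /\
    forall n, (n < j)%N -> `|l n - a k n| < j.+1%:R^-1.
  have e0 : 0 < j.+1%:R^-1 :> R by rewrite invr_gt0.
  have Fj : F [set f | exists2 k, (j <= k)%N & f = a k].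
    by exists j => // k /= jk; exists k.
  have lj m : nbhs (l : {ptws nat -> R})
      [set f : {ptws nat -> R} | forall n, (n < m)%N -> `|l n - f n| < j.+1%:R^-1].
    elim: m => [|m IH]; first exact: filterS filterT.
    have FFl := @nbhs_filter {ptws nat -> R} l.
    apply: (@filterS2 _ _ FFl _ _ _ _ IH (@nbhs_coordinate_ball R l _ m e0)).
    move=> f /= fn fm n; rewrite ltnS leq_eqVlt.
    by move=> /predU1P[->|/fn].
  have [f [[k jk fE] fl]] := Fl _ _ Fj (lj j).
  by exists k; split=> // n nj; rewrite -fE; exact: fl.
have [s sP] := choice near_l; exists s, l; split=> [j|n]; first by case: (sP j).
apply/cvgrPdist_lt => e e0; near=> j.
apply: (@lt_trans _ _ j.+1%:R^-1).
  by apply: (sP j).2; near: j; exact: nbhs_infty_gt.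
by near: j; exact: near_infty_natSinv_lt (PosNum e0).
Unshelve. all: by end_near. Qed.

(** * Polynomials with non-negative coefficients on the half-line *)

Definition psum {R : realType} (a : nat -> R) (N : nat) (t : R) : R :=
  \sum_(0 <= n < N) a n * t ^+ n.

Section PolynomialSums.
Context {R : realType}.
Implicit Types (a : nat -> R) (b : nat -> nat -> R) (t u : R).

Lemma psumB a a' N t : psum (fun n => a n - a' n) N t = psum a N t - psum a' N t.
Proof. by rewrite /psum -sumrB; apply: eq_bigr => n _; rewrite mulrBl. Qed.

Lemma psum_tail a N d t :
  psum a (N + d) t - psum a N t = \sum_(N <= n < N + d) a n * t ^+ n.
Proof. by rewrite /psum (@big_cat_nat _ _ _ N 0%N (N + d)%N) ?leq_addr//= addrAC subrr add0r. Qed.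

(** This pads polynomials of different degrees to a common length, so that they can be
    subtracted. *)
Lemma psum_finsupp a d N t : (forall n, (d <= n)%N -> a n = 0) ->
  psum a (N + d) t = psum a d t.
Proof.
move=> a0; apply/eqP; rewrite -subr_eq0 addnC psum_tail big_nat big1// => n.
by case/andP => dn _; rewrite a0// mul0r.
Qed.

Lemma psum_drop a N d t :
  psum (fun n => if (n < N)%N then 0 else a n) (N + d) t = psum a (N + d) t - psum a N t.
Proof.
rewrite psum_tail /psum (@big_cat_nat _ _ _ N 0%N (N + d)%N) ?leq_addr//=.
rewrite [X in X + _]big_nat [X in X + _]big1 ?add0r => [|n /andP[_ ->]]; last first.
  by rewrite mul0r.
by apply: eq_big_nat => n /andP[Nn _]; rewrite ltnNge Nn.
Qed.

Lemma psum_ge0 a N t : (forall n, 0 <= a n) -> 0 <= t -> 0 <= psum a N t.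
Proof. by move=> a0 t0; apply: sumr_ge0 => n _; rewrite mulr_ge0 ?exprn_ge0. Qed.

Lemma psum_nondecreasing a t : (forall n, 0 <= a n) -> 0 <= t ->
  nondecreasing_seq (fun N => psum a N t).
Proof.
move=> a0 t0 N M NM; rewrite -subr_ge0 -(subnKC NM) psum_tail.
by apply: sumr_ge0 => n _; rewrite mulr_ge0 ?exprn_ge0.
Qed.

Lemma le_psum a N t u : (forall n, 0 <= a n) -> 0 <= t -> t <= u ->
  psum a N t <= psum a N u.
Proof.
move=> a0 t0 tu; apply: ler_sum => n _; apply: ler_wpM2l => //.
by rewrite lerXn2r ?nnegrE// (le_trans t0).
Qed.

(** For [n >= N] one has [t ^+ n = (t / u) ^+ n * u ^+ n], and [t / u < 1] allows the first exponent
    to be lowered to [N]. The tail at [t] is thus geometrically small relative to the value at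
    [u]. *)
Lemma psum_tail_le a N d t u : (forall n, 0 <= a n) -> 0 <= t -> t < u ->
  psum a (N + d) t - psum a N t <= (t / u) ^+ N * psum a (N + d) u.
Proof.
move=> a0 t0 tu; have u0 : 0 < u by exact: le_lt_trans tu.
apply: (@le_trans _ _ ((t / u) ^+ N * (psum a (N + d) u - psum a N u))); last first.
  rewrite ler_wpM2l ?exprn_ge0 ?divr_ge0 ?(ltW u0)// gerBl psum_ge0// ltW//.
rewrite !psum_tail big_distrr /= ler_sum_nat// => n /andP[Nn _].
rewrite mulrCA ler_wpM2l// -(subnKC Nn) !exprD expr_div_n mulrA.
rewrite divfK ?expf_neq0 ?gt_eqF// ler_wpM2l ?exprn_ge0//.
by apply: lerXn2r; rewrite ?nnegrE// ltW.
Qed.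

Lemma cvg_psum b a N t : (forall n, b j n @[j --> \oo] --> a n) ->
  psum (b j) N t @[j --> \oo] --> psum a N t.
Proof.
move=> ba; rewrite /psum; elim: N => [|N IH].
  by rewrite big_geq//; under eq_cvg do rewrite big_geq//; exact: cvg_cst.
rewrite big_nat_recr//=; under eq_cvg do rewrite big_nat_recr//=.
apply: cvgD; first exact: IH.
by apply: cvgM; [exact: ba|exact: cvg_cst].
Qed.

(* Tannery's theorem; comparing with the bound at [u > t] makes the tails of all
   the series at [t] smaller than [(t / u) ^+ N * B]. *)
Lemma cvg_bounded_psum b a (d : nat -> nat) (B t u : R) :
  (forall j n, 0 <= b j n) -> (forall j n, (d j <= n)%N -> b j n = 0) ->
  (forall n, b j n @[j --> \oo] --> a n) ->
  (forall j, psum (b j) (d j) u <= B) -> 0 <= t -> t < u ->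
  cvgn (fun N => psum a N t) /\
  psum (b j) (d j) t @[j --> \oo] --> limn (fun N => psum a N t).
Proof.
move=> b0 bd ba bB t0 tu.
have u0 : 0 < u by exact: le_lt_trans tu.
have a0 n : 0 <= a n.
  rewrite -(cvg_lim (@Rhausdorff R) (ba n)); apply: limr_ge; first exact: cvgP (ba n).
  exact: nearW.
have aB N : psum a N u <= B.
  have cb := cvg_psum b a N u ba.
  rewrite -(cvg_lim (@Rhausdorff R) cb); apply: limr_le; first exact: cvgP cb.
  apply: nearW => j; apply: le_trans (bB j); rewrite -(psum_finsupp _ _ N _ (bd j)).
  by apply: psum_nondecreasing => //; [exact: ltW|exact: leq_addr].
have ca : cvgn (fun N => psum a N t).
  apply: nondecreasing_is_cvgn; first exact: psum_nondecreasing.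
  exists B => _ [N _ <-]; apply: le_trans (aB N).
  by apply: le_psum => //; exact: ltW.
split=> //; set p := limn _.
have r0 : 0 <= t / u by rewrite divr_ge0// ltW.
have r1 : `|t / u| < 1 by rewrite ger0_norm// ltr_pdivrMr// mul1r.
have pN N : `|p - psum a N t| <= (t / u) ^+ N * B.
  rewrite ger0_norm; last first.
    rewrite subr_ge0; apply: (@nondecreasing_cvgn_le _ (fun N => psum a N t)) => //.
    exact: psum_nondecreasing.
  rewrite lerBlDr; apply: limr_le => //; exists N => // M /= NM.
  rewrite -lerBlDr -(subnKC NM); apply: le_trans (psum_tail_le _ _ _ _ _ a0 t0 tu) _.
  by rewrite ler_wpM2l// exprn_ge0.
have bN j N : `|psum (b j) N t - psum (b j) (d j) t| <= (t / u) ^+ N * B.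
  rewrite distrC -(psum_finsupp _ _ N _ (bd j)) ger0_norm; last first.
    by rewrite subr_ge0 psum_nondecreasing// leq_addr.
  apply: le_trans (psum_tail_le _ _ _ _ _ (b0 j) t0 tu) _.
  by rewrite (psum_finsupp _ _ N u (bd j)) ler_wpM2l// exprn_ge0.
have rB : (fun N => (t / u) ^+ N * B) @ \oo --> (0 : R).
  rewrite -[X in _ --> X](mul0r B); apply: cvgM; last exact: cvg_cst.
  exact: cvg_expr.
apply/cvgrPdist_lt => e e0.
(* The bounds [pN] and [bN] are uniform in [j], so [N] is fixed first; only then is [j] taken large,
   for the [N]-th partial sum alone. *)
have e30 : 0 < e / 3 by rewrite divr_gt0.
have /cvgrPdist_lt/(_ _ e30)[N _ /(_ N (leqnn N)) /= rN] := rB.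
rewrite sub0r normrN in rN; have {rN} rN := le_lt_trans (ler_norm _) rN.
have /cvgrPdist_lt/(_ _ e30) := cvg_psum b a N t ba.
apply: filterS => j aj.
have -> : p - psum (b j) (d j) t = (p - psum a N t) + (psum a N t - psum (b j) N t)
   + (psum (b j) N t - psum (b j) (d j) t) by ring.
have -> : e = e / 3 + e / 3 + e / 3 by field.
apply: le_lt_trans (ler_normD _ _) _; apply: ltrD; last exact: le_lt_trans (bN _ _) rN.
apply: le_lt_trans (ler_normD _ _) _; apply: ltrD => //.
exact: le_lt_trans (pN _) rN.
Qed.

End PolynomialSums.

(** * Squared L2 norms with values in the extended reals *)

Definition sqint {d} {T : measurableType d} {R : realType}
  (mu : {measure set T -> \bar R}) (D : set T) (f : T -> R) : \bar R :=
  (\int[mu]_(x in D) (f x ^+ 2)%:E)%E.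

Section SquareIntegral.
Context {d : measure_display} {T : measurableType d} {R : realType}.
Variables (mu : {measure set T -> \bar R}) (D : set T).
Hypothesis mD : measurable D.
Local Open Scope ereal_scope.
Implicit Types f g h : T -> R.

Lemma measurable_sqr f : measurable_fun D f ->
  measurable_fun D (fun x => (f x ^+ 2)%:E : \bar R).
Proof. by move=> mf; apply/measurable_EFinP; exact: measurable_funX. Qed.

Lemma sqint_ge0 f : 0 <= sqint mu D f.
Proof. by apply: integral_ge0 => x _; rewrite lee_fin sqr_ge0. Qed.

Lemma sqint_distC f g :
  sqint mu D (fun x => f x - g x)%R = sqint mu D (fun x => g x - f x)%R.
Proof. by apply: eq_integral => x _; rewrite -sqrrN opprB. Qed.

(** This replaces the triangle inequality. Pointwise, the right-hand side minus the left-hand side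
    is the sum of the squares of the three pairwise differences. *)
Lemma sqint_add3 f g h :
  measurable_fun D f -> measurable_fun D g -> measurable_fun D h ->
  sqint mu D (fun x => f x + g x + h x)%R
    <= 3%:E * (sqint mu D f + sqint mu D g + sqint mu D h).
Proof.
move=> mf mg mh.
have msf := measurable_sqr _ mf; have msg := measurable_sqr _ mg.
have msh := measurable_sqr _ mh.
rewrite /sqint -!ge0_integralD//=; do ?by move=> x _; rewrite ?adde_ge0 ?lee_fin ?sqr_ge0.
  2: by apply: emeasurable_funD.
rewrite -ge0_integralZl//; last 2 first.
- by apply: emeasurable_funD => //; exact: emeasurable_funD.
- by move=> x _; rewrite !adde_ge0 ?lee_fin ?sqr_ge0.
apply: ge0_le_integral => //.
- by move=> x _; rewrite lee_fin sqr_ge0.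
- by apply: measurable_sqr; apply: measurable_funD => //; exact: measurable_funD.
- apply: measurable_funeM.
  by apply: emeasurable_funD => //; exact: emeasurable_funD.
move=> x _; rewrite -!EFinD -EFinM lee_fin.
have := sqr_ge0 (f x - g x); have := sqr_ge0 (g x - h x); have := sqr_ge0 (f x - h x).
lra.
Qed.

(** The squares converge pointwise, so their lower limit is the square of the limit, and Fatou's
    lemma carries the uniform bound over. *)
Lemma sqint_fatou (f_ : nat -> T -> R) f M :
  (forall n, measurable_fun D (f_ n)) ->
  (forall x, D x -> f_ n x @[n --> \oo] --> f x) ->
  (forall n, sqint mu D (f_ n) <= M) -> sqint mu D f <= M.
Proof.
move=> mf ff fM.
have fat := @fatou _ _ _ mu D mD _ (fun n => measurable_sqr _ (mf n)) _.
have -> : sqint mu D f = \int[mu]_(x in D) limn_einf (fun n => (f_ n x ^+ 2)%:E).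
  apply: eq_integral => x; rewrite inE => Dx; apply/esym.
  apply: (cvg_limn_einf_sup _).1; apply: cvg_EFin; first exact: nearW.
  by apply: cvgM; exact: ff.
apply: le_trans (fat _) _; first by move=> n x _; rewrite lee_fin sqr_ge0.
rewrite limn_einf_lim; apply: lime_le; first exact: is_cvg_einfs.
apply: nearW => n; apply: le_trans (fM n); apply: ereal_inf_lbound.
by exists n => /=.
Qed.

(** Since [0 <= f_ n <= f], the function [f ^+ 2] is an integrable majorant of every
    [(f - f_ n) ^+ 2]. *)
Lemma sqint_sub_cvg0 (f_ : nat -> T -> R) f :
  (forall n, measurable_fun D (f_ n)) ->
  (forall x, D x -> f_ n x @[n --> \oo] --> f x) ->
  (forall n x, D x -> 0 <= f_ n x <= f x)%R -> sqint mu D f < +oo ->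
  sqint mu D (fun x => f x - f_ n x)%R @[n --> \oo] --> 0.
Proof.
move=> mf ff f0 fin.
have mlf : measurable_fun D f by exact: measurable_fun_cvg mf ff.
rewrite -[X in _ --> X](integral0 mu D).
apply: (@dominated_cvg _ _ _ mu D mD _ _ (fun x => (f x ^+ 2)%:E)) => //.
- by move=> n; apply: measurable_sqr; exact: measurable_funB.
- move=> x Dx; apply: cvg_EFin; first exact: nearW.
  have f_0 : ((f x - f_ n x)%R @[n --> \oo] --> (0 : R)%R).
    by rewrite -[X in _ --> X](subrr (f x)); apply: cvgB; [exact: cvg_cst|exact: ff].
  by rewrite -[X in _ --> X](@mul0r R 0%R); apply: cvgM.
- apply/integrableP; split; first exact: measurable_sqr.
  apply: le_lt_trans fin; rewrite le_eqVlt; apply/orP; left; apply/eqP.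
  by apply: eq_integral => x _; rewrite gee0_abs// lee_fin sqr_ge0.
- move=> n x Dx; rewrite gee0_abs ?lee_fin ?sqr_ge0//.
  by have /andP[a b] := f0 n x Dx; rewrite lerXn2r ?nnegrE ?subr_ge0 ?gerBl// (le_trans a).
Qed.

End SquareIntegral.

(** * Finite linear combinations and approximation from the cone *)

Definition vsum {R : realType} {V : normedModType R} (v : nat -> V) (a : nat -> R)
  (N : nat) : V := \sum_(0 <= n < N) a n *: v n.

Section VectorSums.
Context {R : realType} {V : normedModType R}.
Implicit Types (v : nat -> V) (a : nat -> R).

Lemma vsumB v a a' N : vsum v (fun n => a n - a' n) N = vsum v a N - vsum v a' N.
Proof. by rewrite /vsum -sumrB; apply: eq_bigr => n _; rewrite scalerBl. Qed.

Lemma vsum_finsupp v a d N : (forall n, (d <= n)%N -> a n = 0) ->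
  vsum v a (N + d) = vsum v a d.
Proof.
move=> a0; rewrite /vsum addnC (@big_cat_nat _ _ _ d 0%N (d + N)%N) ?leq_addr//=.
rewrite [X in _ + X]big_nat [X in _ + X]big1 ?addr0// => n /andP[dn _].
by rewrite a0// scale0r.
Qed.

(** A tail is rewritten as a full sum whose coefficients are still non-negative, so that estimates
    valid for such sums apply to tails. *)
Lemma vsum_drop v a N d :
  vsum v (fun n => if (n < N)%N then 0 else a n) (N + d) = vsum v a (N + d) - vsum v a N.
Proof.
rewrite /vsum !(@big_cat_nat _ _ _ N 0%N (N + d)%N) ?leq_addr//= addrAC subrr add0r.
rewrite [X in X + _]big_nat [X in X + _]big1 ?add0r => [|n /andP[_ ->]]; last first.
  by rewrite scale0r.
by apply: eq_big_nat => n /andP[Nn _]; rewrite ltnNge Nn.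
Qed.

Lemma cvg_vsum v (b : nat -> nat -> R) a N :
  (forall n, b j n @[j --> \oo] --> a n) ->
  vsum v (b j) N @[j --> \oo] --> vsum v a N.
Proof.
move=> ba; rewrite /vsum; elim: N => [|N IH].
  by rewrite big_geq//; under eq_cvg do rewrite big_geq//; exact: cvg_cst.
rewrite big_nat_recr//=; under eq_cvg do rewrite big_nat_recr//=.
apply: cvgD; first exact: IH.
by apply: cvgZr_tmp; exact: ba.
Qed.

(** The coefficients are set to zero from [d k] on, so that sums can be lengthened freely. The
    explicit rate later gives Cauchy estimates without further choices. *)
Lemma closure_cone_approx v x : closure (cone v) x ->
  exists (a : nat -> nat -> R) (d : nat -> nat),
    [/\ forall k n, 0 <= a k n,
        forall k n, (d k <= n)%N -> a k n = 0
      & forall k, `|x - vsum v (a k) (d k)| < k.+1%:R^-1].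
Proof.
move=> clx.
have H k : exists ad : (nat -> R) * nat,
    [/\ forall n, 0 <= ad.1 n, forall n, (ad.2 <= n)%N -> ad.1 n = 0
      & `|x - vsum v ad.1 ad.2| < k.+1%:R^-1].
  have e0 : 0 < k.+1%:R^-1 :> R by rewrite invr_gt0.
  have [_ [[N [a [a0 ->]]]]] := clx _ (nbhsx_ballx x _ e0).
  rewrite -ball_normE /= => xa.
  exists ((fun n => if (n < N)%N then a n else 0), N); split=> [n|n|] /=.
  - by case: ifP.
  - by rewrite ltnNge => ->.
  - rewrite /vsum (eq_big_nat _ _ (F2 := fun n => a n *: v n))// => n /andP[_ nN].
    by rewrite nN.
have [ad adP] := choice H.
by exists (fun k => (ad k).1), (fun k => (ad k).2); split=> k; case: (adP k).
Qed.

End VectorSums.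

(** * Limits of cone elements are sums of series *)

Section ClosedSeriesCone.
Context {R : realType} {V : normedModType R}.
Variables (mu : {measure set (measurableTypeR R) -> \bar R}) (D : set (measurableTypeR R)).
Hypothesis mD : measurable D.
Hypothesis D_ge0 : forall t : R, D t -> 0 <= t.
Hypothesis D_tail : forall t : R, D t ->
  exists2 u : R, t < u & (0 < mu (D `&` [set s : R | (u <= s)%R]))%E.
Variables (v : nat -> V) (c : R).
Hypothesis c_ge0 : 0 <= c.
(** Coefficients of any sign are allowed here because the bound is applied to differences of
    approximants; the reverse bound below is used on non-negative tails. *)
Hypothesis sqint_le_vsum : forall a N,
  (sqint mu D (psum a N) <= (`|vsum v a N| ^+ 2)%:E)%E.
Hypothesis vsum_le_sqint : forall a N, (forall n, 0 <= a n) ->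
  ((`|vsum v a N| ^+ 2)%:E <= c%:E * sqint mu D (psum a N))%E.

Lemma measurable_psum a N : measurable_fun D (psum a N : measurableTypeR R -> R).
Proof.
apply: measurable_sum => n; apply: measurable_funM; first exact: measurable_cst.
exact: exprn_measurable.
Qed.

(** A polynomial with non-negative coefficients is at least its value at [u] on all of [E], so the
    square of that value times [mu E] is at most [M]. The resulting bound does not depend on the
    polynomial. *)
Lemma psum_le_sqint (u M : R) : 0 <= u ->
  (0 < mu (D `&` [set s : R | (u <= s)%R]))%E ->
  exists B : R, forall a N, (forall n, 0 <= a n) ->
    (sqint mu D (psum a N) <= M%:E)%E -> psum a N u <= B.
Proof.
move=> u0; set E := D `&` _ => mE.
have mEm : measurable E.
  apply: measurableI => //; have -> : [set s : R | u <= s] = `[u, +oo[%classic.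
    by apply/seteqP; split=> s /=; rewrite in_itv /= andbT.
  exact: measurable_itv.
(* As [mu E] may be infinite, a finite positive lower bound [m] is used as divisor. *)
have [m m0 mle] : exists2 m : R, 0 < m & (m%:E <= mu E)%E.
  case: (mu E) mE => [r||] //=; last by exists 1; rewrite ?leey.
  by rewrite lte_fin => r0; exists r.
(* From [P ^+ 2 <= M / m] and [P <= 1 + P ^+ 2], which avoids a square root. *)
exists (1 + M / m) => a N a0 aM.
set P := psum a N u; have P0 : 0 <= P by exact: psum_ge0.
have : ((P ^+ 2)%:E * mu E <= M%:E)%E.
  apply: le_trans aM; rewrite -integral_cst//.
  apply: (@le_trans _ _ (sqint mu E (psum a N))); last first.
    apply: ge0_subset_integral => //.
    - by apply: measurable_sqr; exact: measurable_psum.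
    - by move=> x _; rewrite lee_fin sqr_ge0.
    - by move=> t [].
  apply: ge0_le_integral => //.
  - by move=> x _; rewrite lee_fin sqr_ge0.
  - by apply: measurable_sqr; apply: measurable_funS mD _ (measurable_psum a N) => t [].
  - move=> x [Dx /= ux]; rewrite lee_fin lerXn2r ?nnegrE ?psum_ge0// ?D_ge0//.
    exact: le_psum.
move=> PM; have : ((P ^+ 2 * m)%:E <= M%:E)%E.
  by apply: le_trans PM; rewrite EFinM lee_pmul// lee_fin ?sqr_ge0 ?ltW.
rewrite lee_fin -ler_pdivlMr// => PMm.
by have := sqr_ge0 (P - 1); nra.
Qed.

Lemma closure_cone_sub_series_cone : closure (cone v) `<=` series_cone v.
Proof.
move=> x /closure_cone_approx[a [d [a0 ad xa]]].
have inv0 : (fun j : nat => j.+1%:R^-1 : R) @ \oo --> (0 : R) by exact: cvg_harmonic.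
(* If [D] is empty the coefficients are not controlled, but every [vsum v] vanishes. *)
have [DE|/set0P[t0 Dt0]] := eqVneq D set0.
  have v0 k : vsum v (a k) (d k) = 0.
    have := vsum_le_sqint (a k) (d k) (a0 k).
    rewrite DE /sqint integral_set0 mule0 lee_fin => h.
    by apply/eqP; rewrite -normr_eq0 -sqrf_eq0 eq_le h sqr_ge0.
  have -> : x = 0.
    apply/eqP; rewrite -normr_le0 -(cvg_lim (@Rhausdorff R) inv0).
    apply: limr_ge; first exact: cvgP inv0.
    by apply: nearW => k; have := ltW (xa k); rewrite v0 subr0.
  exists (fun=> 0); split=> //; under eq_fun do rewrite scale0r.
  have -> : series (fun=> 0 : V) = fun=> 0 by apply/funext => N; rewrite /series/= big1.
  exact: cvg_cst.
pose M := (`|x| + 1) ^+ 2.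
have aM k : (sqint mu D (psum (a k) (d k)) <= M%:E)%E.
  apply: le_trans (sqint_le_vsum _ _) _; rewrite lee_fin lerXn2r ?nnegrE ?addr_ge0//.
  have -> : vsum v (a k) (d k) = x - (x - vsum v (a k) (d k)) by rewrite opprB addrC subrK.
  apply: le_trans (ler_normB _ _) _; rewrite lerD2l; apply: le_trans (ltW (xa k)) _.
  by rewrite invf_le1// ler1n.
have aB t : D t -> exists u B, t < u /\ forall k, psum (a k) (d k) u <= B.
  move=> Dt; have [u tu mu0] := D_tail _ Dt.
  have u0 : 0 <= u by exact: le_trans (D_ge0 _ Dt) (ltW tu).
  by have [B BP] := psum_le_sqint u M u0 mu0; exists u, B; split=> // k; exact: BP.
(* One point [t0] of [D] is enough to choose the subsequence: with [u > t0], each coefficient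
   satisfies [a k n * u ^+ n <= B]. Convergence at the other points of [D] then follows from their
   own bounds. *)
have [s [l [sj sl]]] : exists (s : nat -> nat) (l : nat -> R),
    (forall j, (j <= s j)%N) /\ forall n, a (s j) n @[j --> \oo] --> l n.
  have [u [B [tu BP]]] := aB _ Dt0.
  have u0 : 0 < u by exact: le_lt_trans (D_ge0 _ Dt0) tu.
  apply: (@bounded_diagonal_extraction _ _ (fun n => B / u ^+ n)) => k n.
  rewrite a0/= ler_pdivlMr ?exprn_gt0//; apply: le_trans (BP k).
  rewrite -(psum_finsupp _ _ n.+1 _ (ad k)).
  apply: le_trans (psum_nondecreasing _ _ (a0 k) (ltW u0) _ _ (leq_addr _ _)).
  by rewrite /psum big_nat_recr//= lerDr -/(psum _ _ _) psum_ge0// ltW.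
pose b j := a (s j); pose e j := d (s j); pose P j := psum (b j) (e j).
have be j n : (e j <= n)%N -> b j n = 0 by exact: ad.
have b0 j n : 0 <= b j n by exact: a0.
have xb j : `|x - vsum v (b j) (e j)| <= j.+1%:R^-1.
  apply: le_trans (ltW (xa _)) _; rewrite lef_pV2 ?posrE// ler_nat ltnS; exact: sj.
have l0 n : 0 <= l n.
  rewrite -(cvg_lim (@Rhausdorff R) (sl n)); apply: limr_ge; first exact: cvgP (sl n).
  by apply: nearW => j; exact: b0.
pose p t := limn (fun N => psum l N t).
have PpD t : D t -> cvgn (fun N => psum l N t) /\ P j t @[j --> \oo] --> p t.
  move=> Dt; have [u [B [tu BP]]] := aB _ Dt.
  by apply: (cvg_bounded_psum b l e B t u) => //; [move=> j; exact: BP|exact: D_ge0].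
have mp : measurable_fun D (p : measurableTypeR R -> R).
  by apply: (@measurable_fun_cvg _ _ _ D P) => [j|t /PpD[]//]; exact: measurable_psum.
have pM : (sqint mu D p <= M%:E)%E.
  apply: (@sqint_fatou _ _ _ mu D mD P) => [j|t /PpD[]//|j]; last exact: aM.
  exact: measurable_psum.
(* Fatou's lemma is applied in [i] with [j] fixed. The difference of two approximants has signed
   coefficients, and its norm is at most the sum of their distances to [x], each at most
   [j.+1%:R^-1]. *)
have pP j : (sqint mu D (fun t => p t - P j t)%R <= ((2 * j.+1%:R^-1) ^+ 2)%:E)%E.
  apply: (@sqint_fatou _ _ _ mu D mD (fun i t => P (i + j)%N t - P j t)).
  - by move=> i; apply: measurable_funB; exact: measurable_psum.
  - move=> t /PpD[_ Pp]; apply: cvgB; last exact: cvg_cst.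
    by rewrite (cvg_shiftn j (P ^~ t)).
  move=> i; have -> : (fun t => P (i + j)%N t - P j t) =
      psum (fun n => b (i + j)%N n - b j n) (e j + e (i + j)%N).
    apply/funext => t; rewrite psumB (psum_finsupp _ _ _ _ (be (i + j)%N)).
    by rewrite [(e j + _)%N]addnC (psum_finsupp _ _ _ _ (be j)).
  apply: le_trans (sqint_le_vsum _ _) _; rewrite lee_fin lerXn2r ?nnegrE//.
  rewrite vsumB (vsum_finsupp _ _ _ _ (be (i + j)%N)) [(e j + _)%N]addnC (vsum_finsupp _ _ _ _ (be j)).
  have -> : vsum v (b (i + j)%N) (e (i + j)%N) - vsum v (b j) (e j) =
    (x - vsum v (b j) (e j)) - (x - vsum v (b (i + j)%N) (e (i + j)%N)).
    by rewrite opprB [RHS]addrC addrA subrK.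
  apply: le_trans (ler_normB _ _) _; rewrite mulr_natl mulr2n lerD//.
  apply: le_trans (xb _) _; rewrite lef_pV2 ?posrE// ler_nat ltnS; exact: leq_addl.
have pS : (sqint mu D (fun t => p t - psum l N t)%R @[N --> \oo] --> 0)%E.
  apply: (@sqint_sub_cvg0 _ _ _ mu D mD (psum l)).
  - by move=> N; exact: measurable_psum.
  - by move=> t /PpD[].
  - move=> N t Dt; have [cl _] := PpD _ Dt; rewrite psum_ge0 ?D_ge0//=.
    apply: (@nondecreasing_cvgn_le _ (fun N => psum l N t)) => //.
    by apply: psum_nondecreasing; rewrite ?D_ge0.
  - exact: le_lt_trans pM (ltry _).
exists l; split=> //.
have key N (del : R) : (sqint mu D (fun t => p t - psum l N t)%R <= del%:E)%E ->
    `|x - vsum v l N| ^+ 2 <= 6 * c * del.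
  move=> Sdel.
  (* [r j] collects the errors that vanish as [j] grows while [N] stays fixed. *)
  pose r j := j.+1%:R^-1 + `|vsum v l N - vsum v (b j) N|.
  have r_cvg : r j @[j --> \oo] --> (0 : R).
    rewrite -[X in _ --> X](addr0 0); apply: cvgD => //.
    rewrite -(@normr0 _ V) -(subrr (vsum v l N)).
    by apply: cvg_norm; apply: cvgB; [exact: cvg_cst|exact: cvg_vsum].
  (* With [h] and [eta] the two summands of [r j], the squared distance is at most
     [2 * r j ^+ 2 + 2 * |T| ^+ 2], and [|T| ^+ 2 <= 3 * c * (4 * h ^+ 2 + del + eta ^+ 2)]. This
     produces [6 * c * del], and [24 * c * h ^+ 2 + 6 * c * eta ^+ 2] is absorbed in
     [30 * c * r j ^+ 2]. *)
  have bound j : `|x - vsum v l N| ^+ 2 <= (2 + 30 * c) * r j ^+ 2 + 6 * c * del.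
    pose T := vsum v (b j) (e j) - vsum v (b j) N.
    have xT : `|x - vsum v l N| <= r j + `|T|.
      have -> : x - vsum v l N = (x - vsum v (b j) (e j))
          - (vsum v l N - vsum v (b j) N) + T.
        by rewrite opprB addrAC /T !subrKA.
      apply: le_trans (ler_normD _ _) _; rewrite lerD2r.
      by apply: le_trans (ler_normB _ _) _; rewrite lerD2r.
    have TE : `|T| ^+ 2 <= 3 * c * ((2 * j.+1%:R^-1) ^+ 2 + del
                + `|vsum v l N - vsum v (b j) N| ^+ 2).
      (* [T] is the part of the approximant of degree at least [N]; its coefficients are
         non-negative, so the upper bound applies. *)
      pose b' n := if (n < N)%N then 0 else b j n.
      have -> : T = vsum v b' (N + e j) by rewrite vsum_drop (vsum_finsupp _ _ _ _ (be j)).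
      have b'0 n : 0 <= b' n by rewrite /b'; case: ifP.
      rewrite -lee_fin; apply: le_trans (vsum_le_sqint _ _ b'0) _.
      rewrite [3 * c]mulrC -mulrA EFinM lee_wpmul2l//.
      have -> : psum b' (N + e j) = (fun t => (P j t - p t) + (p t - psum l N t)
          + (psum l N t - psum (b j) N t)).
        apply/funext => t; rewrite psum_drop (psum_finsupp _ _ _ _ (be j)) /P.
        by ring.
      apply: le_trans (@sqint_add3 _ _ _ mu D mD _ _ _ _ _ _) _; last first.
      - rewrite EFinM lee_wpmul2l// !EFinD; apply: leeD; first apply: leeD => //.
        + by rewrite sqint_distC; exact: pP.
        + rewrite -vsumB; apply: le_trans (sqint_le_vsum _ _).
          by under eq_fun do rewrite -psumB.
      - by apply: measurable_funB; exact: measurable_psum.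
      - by apply: measurable_funB => //; exact: measurable_psum.
      - by apply: measurable_funB => //; exact: measurable_psum.
    have h0 : 0 <= j.+1%:R^-1 :> R by [].
    move: xT TE; rewrite /r; move: h0 (normr_ge0 (vsum v l N - vsum v (b j) N)).
    move: (normr_ge0 T) (normr_ge0 (x - vsum v l N)).
    move: (j.+1%:R^-1) `|T| `|x - _| `|vsum v l N - _| => h T' y eta T0 y0 h0 eta0 yT TE.
    have y2 : y ^+ 2 <= 2 * (h + eta) ^+ 2 + 2 * T' ^+ 2.
      have := sqr_ge0 (h + eta - T'); nra.
    have hc : 0 <= c * (h * eta) by rewrite !mulr_ge0.
    have he : 0 <= c * eta ^+ 2 by rewrite mulr_ge0 ?sqr_ge0.
    have hh : 0 <= c * h ^+ 2 by rewrite mulr_ge0 ?sqr_ge0.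
    nra.
  have lim : (2 + 30 * c) * r j ^+ 2 + 6 * c * del @[j --> \oo] --> 6 * c * del.
    rewrite -[X in _ --> X]add0r; apply: cvgD; last exact: cvg_cst.
    rewrite -[X in _ --> X](mulr0 (2 + 30 * c)); apply: cvgM; first exact: cvg_cst.
    by rewrite -[X in _ --> X](mulr0 (0 : R)); apply: cvgM.
  rewrite -(cvg_lim (@Rhausdorff R) lim); apply: limr_ge; first exact: cvgP lim.
  exact: nearW.
apply/cvgrPdist_lt => eps eps0.
(* The added 1 keeps the divisor positive when [c = 0] and makes [6 * c * del] strictly smaller than
   [eps ^+ 2]. *)
have c1 : 0 < 6 * c + 1 by rewrite ltr_wpDl// mulr_ge0.
have del0 : 0 < eps ^+ 2 / (6 * c + 1) by rewrite divr_gt0 ?exprn_gt0.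
move/fine_cvgP : pS => [fin /cvgrPdist_lt/(_ _ del0)].
apply: filterS2 fin => N finN; rewrite sub0r normrN => /(le_lt_trans (ler_norm _)) dN.
have := key N _ _; rewrite -ltr_sqr ?nnegrE ?(ltW eps0)//.
move=> /(_ (eps ^+ 2 / (6 * c + 1))) kN; apply: le_lt_trans (kN _) _.
  by rewrite -(fineK finN) lee_fin ltW.
by rewrite mulrA ltr_pdivrMr// mulrC ltr_pM2l ?exprn_gt0// ltrDl.
Qed.

End ClosedSeriesCone.

(** * Invariance of both cones under positive rescaling *)

Section RescaledCone.
Context {R : realType} {V : normedModType R}.
Variables (v : nat -> V) (lam : nat -> R).
Hypothesis lam_gt0 : forall n, 0 < lam n.

Lemma cone_rescale : cone (fun n => lam n *: v n) = cone v.
Proof.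
apply/seteqP; split=> x [N [a [a0 ->]]].
- exists N, (fun n => a n * lam n); split=> [n|]; first by rewrite mulr_ge0// ltW.
  by apply: eq_bigr => n _; rewrite scalerA.
- exists N, (fun n => a n / lam n); split=> [n|]; first by rewrite divr_ge0// ltW.
  by apply: eq_bigr => n _; rewrite scalerA divfK// gt_eqF.
Qed.

Lemma series_cone_rescale : series_cone (fun n => lam n *: v n) = series_cone v.
Proof.
apply/seteqP; split=> x [a [a0 ax]].
- exists (fun n => a n * lam n); split=> [n|]; first by rewrite mulr_ge0// ltW.
  by under eq_fun do rewrite -scalerA.
- exists (fun n => a n / lam n); split=> [n|]; first by rewrite divr_ge0// ltW.
  by under eq_fun do rewrite scalerA divfK ?gt_eqF//.
Qed.

Lemma series_cone_sub_closure_cone : series_cone v `<=` closure (cone v).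
Proof.
move=> x [a [a0 ax]] B /ax[N _ /(_ N (leqnn N)) BN].
by exists (series (fun n => a n *: v n) N); split=> //; exists N, a.
Qed.

End RescaledCone.

(** * Gram expansions and integrals of linear combinations *)

Lemma sqr_norm_vsum {R : realType} {V : normedModType R} (ip : V -> V -> R) (v : nat -> V)
    (a : nat -> R) (N : nat) : is_inner_product ip ->
  `|vsum v a N| ^+ 2 = \sum_(0 <= n < N) a n * \sum_(0 <= m < N) a m * ip (v n) (v m).
Proof.
move=> [ipC ipL ->].
have ip0 z : ip 0 z = 0.
  by have := ipL 1 0 0 z; rewrite scaler0 addr0; lra.
have ipZ k x z : ip (k *: x) z = k * ip x z by rewrite -[k *: x]addr0 ipL ip0 addr0.
have ip_sum z M : ip (vsum v a M) z = \sum_(0 <= n < M) a n * ip (v n) z.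
  rewrite /vsum; elim: M => [|M IH]; first by rewrite !big_geq.
  by rewrite !big_nat_recr//= addrC ipL IH addrC.
rewrite ip_sum; apply: eq_bigr => n _; rewrite ipC ip_sum; congr (_ * _).
by apply: eq_bigr => m _; rewrite ipC.
Qed.

(** Integrability and value share one induction, since additivity of the integral requires the sum
    so far to be integrable. *)
Lemma Rintegral_lincomb {d} {T : measurableType d} {R : realType}
    (mu : {measure set T -> \bar R}) (D : set T) (g : nat -> T -> R) (a : nat -> R) (N : nat) :
  measurable D -> (forall n, mu.-integrable D (EFin \o g n)) ->
  mu.-integrable D (EFin \o (fun x => \sum_(0 <= n < N) a n * g n x)) /\
  \int[mu]_(x in D) (\sum_(0 <= n < N) a n * g n x) =
    \sum_(0 <= n < N) a n * \int[mu]_(x in D) g n x.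
Proof.
move=> mD ig; elim: N => [|N [iN IH]].
  under eq_fun do rewrite big_geq//; rewrite big_geq//; split.
    exact: integrable0.
  by rewrite Rintegral_cst// mul0r.
have iZ : mu.-integrable D (EFin \o (fun x => a N * g N x)).
  exact: integrableZl (ig N).
have E : (fun x => \sum_(0 <= n < N.+1) a n * g n x) =
  (fun x => \sum_(0 <= n < N) a n * g n x + a N * g N x).
  by apply/funext => x; rewrite big_nat_recr.
rewrite E; split; first exact: (integrableD mD iN iZ).
by rewrite RintegralD// IH RintegralZl// big_nat_recr.
Qed.

(** * The half-line below the supremum of the support *)

Definition halfline_below {R : realType} (s : \bar R) : set (measurableTypeR R) :=
  [set t : R | 0 <= t /\ (t%:E < s)%E].

Lemma measurable_halfline_below {R : realType} (s : \bar R) :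
  measurable (halfline_below s).
Proof.
case: s => [r||].
- have -> : halfline_below r%:E = `[0, r[%classic.
    by apply/seteqP; split=> t /=; rewrite /halfline_below/= in_itv/= lte_fin => /andP.
  exact: measurable_itv.
- have -> : halfline_below +oo%E = `[0, +oo[%classic :> set R.
    apply/seteqP; split=> t /=; rewrite /halfline_below/= in_itv/= andbT ?ltry; first by case.
    by move=> t0; split.
  exact: measurable_itv.
(* An empty support has supremum [-oo]. *)
- have -> : halfline_below (-oo : \bar R)%E = set0.
    by apply/seteqP; split=> // t [_]; rewrite ltNge leNye.
  exact: measurable0.
Qed.

(** Some point [y] of the support lies beyond [t]. With [u] halfway between them, the open ray above
    [u] contains [y], hence has positive mass, and it is covered by the set in question together
    with the null set [Z]. *)
Lemma halfline_tail_gt0 {R : realType} (mu : {measure set (measurableTypeR R) -> \bar R}) :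
  mu [set t : R | 0 <= t /\ (msup_support mu <= t%:E)%E] = 0%E ->
  forall t : R, halfline_below (msup_support mu) t ->
  exists2 u : R, t < u &
    (0 < mu (halfline_below (msup_support mu) `&` [set s : R | (u <= s)%R]))%E.
Proof.
set S := msup_support mu; set Z := [set t | _]; set D := halfline_below S.
move=> Z0 t [t0 /ereal_sup_gt[_ [y ysupp <-]]]; rewrite lte_fin => ty.
pose u := (t + y) / 2; have tu : t < u by rewrite /u; lra.
have uy : u < y by rewrite /u; lra.
exists u => //; set E := D `&` _.
have mD : measurable D by exact: measurable_halfline_below.
have mE : measurable E.
  apply: measurableI => //; have -> : [set s : R | u <= s] = `[u, +oo[%classic.
    by apply/seteqP; split=> s /=; rewrite in_itv /= andbT.
  exact: measurable_itv.
have mZ : measurable Z.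
  have -> : Z = `[0, +oo[%classic `\` D.
    apply/seteqP; split=> s /=; rewrite in_itv/= andbT.
      by move=> [s0 Ss]; split=> // -[_]; rewrite ltNge Ss.
    move=> [s0 nD]; split=> //; rewrite leNgt; apply/negP => sS; exact: nD.
  by apply: measurableD => //; exact: measurable_itv.
have := ysupp `]u, +oo[%classic (interval_open _ _) _.
rewrite /= in_itv/= uy => /(_ isT isT isT) /lt_le_trans; apply.
apply: (@le_trans _ _ (mu (E `|` Z))); last first.
  by rewrite measureU0.
apply: le_measure; rewrite ?inE//; first exact: measurableU.
move=> s /=; rewrite in_itv/= andbT => us.
have s0 : 0 <= s by lra.
by have [Ss|sS] := leP S s%:E; [right|left; split=> //; exact: ltW].
Qed.

(** * Verification of the two norm estimates and conclusion *)

Theorem theorem1p1 (R : realType)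
  (mu : {measure set (measurableTypeR R) -> \bar R})
  (mu_neg : mu [set t : R | t < 0] = 0%E)
  (mu_moments : forall n : nat,
     (\int[mu]_(t in [set t : R | (0 <= t)%R]) ((t ^+ n)%R%:E) < +oo)%E)
  (mu_smu : mu [set t : R | 0 <= t /\ (msup_support mu <= t%:E)%E] = 0%E)
  (K : completeNormedModType R) (ipK : K -> K -> R) (hipK : is_inner_product ipK)
  (w : nat -> K) (C : R) (C_gt0 : 0 < C)
  (hw : forall (N : nat) (a : nat -> R), (forall n, 0 <= a n) ->
     `| \sum_(0 <= n < N) a n *: w n | <=
       C * Num.sqrt (\int[mu]_(t in [set t : R | (0 <= t)%R])
                       ((\sum_(0 <= n < N) a n * t ^+ n) ^+ 2)))
  (H : completeNormedModType R) (ipH : H -> H -> R) (hipH : is_inner_product ipH)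
  (lambda : nat -> R) (lambda_gt0 : forall n, 0 < lambda n)
  (v : nat -> H)
  (hv : forall n m : nat,
     ipH (lambda n *: v n) (lambda m *: v m) =
       (\int[mu]_(t in [set t : R | (0 <= t)%R]) (t ^+ (m + n))) + ipK (w n) (w m)) :
  closure (cone v) = series_cone v /\ closed (series_cone v).
Proof.
set D0 := [set t : R | 0 <= t] in mu_moments hw hv *.
pose D := halfline_below (msup_support mu).
have mD0 : measurable (D0 : set (measurableTypeR R)).
  have -> : D0 = `[0, +oo[%classic by apply/seteqP; split=> s /=; rewrite in_itv/= andbT.
  exact: measurable_itv.
have mD : measurable D by exact: measurable_halfline_below.
have imon n : mu.-integrable D0 (EFin \o (fun t : R => t ^+ n)).
  apply/integrableP; split; first by apply/measurable_EFinP; exact: exprn_measurable.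
  apply: le_lt_trans (mu_moments n); rewrite le_eqVlt; apply/orP; left; apply/eqP.
  by apply: eq_integral => t; rewrite inE => t0; rewrite /= ger0_norm// exprn_ge0.
pose I n := \int[mu]_(t in D0) t ^+ n.
have ipsum a N m : mu.-integrable D0 (EFin \o (fun t : R => psum a N t * t ^+ m)) /\
    \int[mu]_(t in D0) (psum a N t * t ^+ m) = \sum_(0 <= n < N) a n * I (n + m)%N.
  have -> : (fun t => psum a N t * t ^+ m) =
      (fun t => \sum_(0 <= n < N) a n * (fun t => t ^+ (n + m)) t).
    by apply/funext => t; rewrite /psum mulr_suml; apply: eq_bigr => n _; rewrite exprD mulrA.
  by apply: (@Rintegral_lincomb _ _ _ mu D0 (fun n t => t ^+ (n + m))).
have ipsum2 a N : mu.-integrable D0 (EFin \o (fun t : R => psum a N t ^+ 2)) /\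
    \int[mu]_(t in D0) (psum a N t ^+ 2) =
      \sum_(0 <= m < N) a m * \sum_(0 <= n < N) a n * I (n + m)%N.
  have -> : (fun t => psum a N t ^+ 2) =
      (fun t => \sum_(0 <= m < N) a m * (fun t => psum a N t * t ^+ m) t).
    apply/funext => t; rewrite expr2 {2}/psum mulr_sumr.
    by apply: eq_bigr => m _; rewrite mulrCA.
  have [|-> ->] := @Rintegral_lincomb _ _ _ mu D0 (fun m t => psum a N t * t ^+ m) a N mD0.
    by move=> m; case: (ipsum a N m).
  by split=> //; apply: eq_bigr => m _; case: (ipsum a N m) => _ ->.
(* [D] and [D0] differ by the null set of [mu_smu], and finite moments make the integral finite. *)
have sqintE a N : sqint mu D (psum a N) = (\int[mu]_(t in D0) (psum a N t ^+ 2))%:E.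
  rewrite /Rintegral fineK; last by apply: integrable_fin_num => //; case: (ipsum2 a N).
  have -> : D = D0 `\` [set t : R | 0 <= t /\ (msup_support mu <= t%:E)%E].
    apply/seteqP; split=> t.
      by move=> [t0 tS]; split=> // -[_]; rewrite leNgt tS.
    by move=> [t0 nt]; split=> //; rewrite ltNge; apply/negP => St; exact: nt.
  apply/esym; apply: negligible_integral => //; last by case: (ipsum2 a N).
  have -> : [set t : R | 0 <= t /\ (msup_support mu <= t%:E)%E] = D0 `\` D.
    apply/seteqP; split=> t.
      by move=> [t0 St]; split=> // -[_]; rewrite ltNge St.
    by move=> [t0 nD]; split=> //; rewrite leNgt; apply/negP => tS; exact: nD.
  exact: measurableD.
pose v' n := lambda n *: v n.
(* The moments form the Gram matrix of the monomials, so [hv] splits the squared norm into an L2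
   part and a part from [w]. Dropping the latter gives [low]; bounding it by [hw] gives [up] with
   constant [1 + C ^+ 2]. *)
have normE a N : `|vsum v' a N| ^+ 2 =
    \int[mu]_(t in D0) (psum a N t ^+ 2) + `|vsum w a N| ^+ 2.
  rewrite (sqr_norm_vsum _ _ _ _ hipH) (sqr_norm_vsum _ _ _ _ hipK) (ipsum2 a N).2.
  rewrite -big_split; apply: eq_bigr => n _ /=; rewrite -mulrDr -big_split.
  by congr (_ * _); apply: eq_bigr => m _ /=; rewrite -mulrDr hv.
have low a N : (sqint mu D (psum a N) <= (`|vsum v' a N| ^+ 2)%:E)%E.
  by rewrite sqintE lee_fin normE lerDl sqr_ge0.
have up a N : (forall n, 0 <= a n) ->
    ((`|vsum v' a N| ^+ 2)%:E <= (1 + C ^+ 2)%:E * sqint mu D (psum a N))%E.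
  move=> a0; rewrite sqintE -EFinM lee_fin normE mulrDl mul1r lerD2l.
  set J := Rintegral _ _ _; have J0 : 0 <= J by apply: Rintegral_ge0 => t _; exact: sqr_ge0.
  rewrite -(sqr_sqrtr J0) -exprMn lerXn2r ?nnegrE ?mulr_ge0 ?sqrtr_ge0 ?(ltW C_gt0)//.
  exact: hw.
have sub : closure (cone v) `<=` series_cone v.
  rewrite -(cone_rescale v lambda)// -(series_cone_rescale v lambda)//.
  apply: (closure_cone_sub_series_cone mu D mD _ _ v' (1 + C ^+ 2)) => //.
  - by move=> t [].
  - exact: halfline_tail_gt0.
  - by rewrite addr_ge0 ?sqr_ge0.
have clE : closure (cone v) = series_cone v.
  by apply/seteqP; split=> //; exact: series_cone_sub_closure_cone.
by split=> //; rewrite -clE; exact: closed_closure.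
Qed.
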